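(* Let $k\ge 2$ and let $\Gamma$ be any generating set of $G_{k,1}$ (possibly infinite). The map $\rho:(G_{k,1}^{\sim\mathcal L})_{\Gamma}\to\mathsf{riAut}(k)$ is finite-to-one, i.e. $\rho^{-1}(\varphi)$ is finite for every $\varphi\in\mathsf{riAut}(k)$. It follows that the corresponding map $(F_{k,1}^{\sim\mathcal L})_{\Gamma}\to\mathsf{riAut}_{\mathsf{dict}}(k)$, for $\Gamma$ any generating set of $F_{k,1}$, is also finite-to-one.
   Context: Let $A=\{a_1<\dots<a_k\}$ be an ordered alphabet with $k\ge 2$ letters and $A^*$ the free monoid. A right ideal is $R\subseteq A^*$ with $RA^*\subseteq R$; it is essential iff it intersects every (nonempty) right ideal. $\mathsf{riAut}(k)$ is the monoid (under composition of partial functions) of all bijections $\varphi:R_1\to R_2$ between finitely generated essential right ideals with $\varphi(xw)=\varphi(x)w$; $\mathsf{Dom}(\varphi)=R_1$. $\mathsf{riAut}_{\mathsf{dict}}(k)$ is the submonoid of those $\varphi$ that preserve the dictionary order (prefixes come first; prefix-incomparable words are compared by the first letter where they differ). Every $\varphi\in\mathsf{riAut}(k)$ has a unique maximal extension $\max(\varphi)\in\mathsf{riAut}(k)$. $G_{k,1}=\{\max(\varphi):\varphi\in\mathsf{riAut}(k)\}$ with multiplication $\psi\cdot\varphi=\max(\psi\circ\varphi)$ is a group; $F_{k,1}=\{\max(\varphi):\varphi\in\mathsf{riAut}_{\mathsf{dict}}(k)\}$ is a subgroup. For $g\in G_{k,1}$, $\mathsf{Dom}(g)$ is the domain of $g$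 as a maximally extended map. For a monoid $M$ with (monoid) generating set $\Gamma$, the $\Gamma$-generated suffix expansion $(\tilde M^{\mathcal L})_{\Gamma}$ (written $(G^{\sim\mathcal L})_\Gamma$ when $M=G$) is the submonoid generated by $\{(\gamma,\{\gamma,1\}):\gamma\in\Gamma\}$ of the monoid of pairs $(x,S)$ with $x\in M$, $S\subseteq M$ finite, with multiplication $(y,T)\cdot(x,S)=(yx,\ Tx\cup S)$, where $Tx=\{tx:t\in T\}$. The map $\rho$ is given by $\rho(g,S)=(g,\bigcap_{h\in S}\mathsf{Dom}(h))$, where a pair $(g,R)$ with $R\subseteq\mathsf{Dom}(g)$ a finitely generated essential right ideal is identified with the element of $\mathsf{riAut}(k)$ that is the restriction of $g$ to $R$. The map for $F_{k,1}$ is given by the same formula. *)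

(* Defs.v *)
From mathcomp Require Import all_boot all_order.
From mathcomp Require Import boolp classical_sets functions cardinality.

Set Implicit Arguments.
Unset Strict Implicit.
Unset Printing Implicit Defensive.

Local Open Scope classical_set_scope.

(* The ordered alphabet a_1 < ... < a_k is 'I_k. *)
Definition word (k : nat) : Type := seq 'I_k.

Definition right_ideal (k : nat) (R : set (word k)) : Prop :=
  forall x w : word k, R x -> R (x ++ w).

Definition essential (k : nat) (R : set (word k)) : Prop :=
  forall R' : set (word k), right_ideal R' -> R' !=set0 -> (R `&` R') !=set0.

Definition finitely_generated (k : nat) (R : set (word k)) : Prop :=
  exists2 C : set (word k), finite_set C &
    R = [set x | exists c w : word k, C c /\ x = c ++ w].

Definition fg_essential_ri (k : nat) (R : set (word k)) : Prop :=
  [/\ right_ideal R, essential R & finitely_generated R].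

(* Partial functions on words; with functional extensionality, Leibniz equality
   of such functions is equality of partial functions, domain included. *)
Definition pfun (k : nat) : Type := word k -> option (word k).

Definition Dom (k : nat) (phi : pfun k) : set (word k) :=
  [set x | exists y : word k, phi x = Some y].

Definition Im (k : nat) (phi : pfun k) : set (word k) :=
  [set y | exists x : word k, phi x = Some y].

Definition riAut (k : nat) : set (pfun k) :=
  [set phi | [/\ fg_essential_ri (Dom phi),
                 fg_essential_ri (Im phi),
                 (forall x x' y : word k,
                    phi x = Some y -> phi x' = Some y -> x = x')
               & (forall x y w : word k,
                    phi x = Some y -> phi (x ++ w) = Some (y ++ w))]].
Arguments riAut k : clear implicits.

(* The lexicographic order of [seqlexi] puts prefixes first and compares
   prefix-incomparable words at the first letter where they differ. *)
Definition dict_le (k : nat) (u v : word k) : Prop :=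
  ((u : seqlexi 'I_k) <= (v : seqlexi 'I_k))%O.

Definition dict_preserving (k : nat) (phi : pfun k) : Prop :=
  forall x x' y y' : word k, phi x = Some y -> phi x' = Some y' ->
    dict_le x x' -> dict_le y y'.

Definition riAut_dict (k : nat) : set (pfun k) :=
  riAut k `&` [set phi | dict_preserving phi].
Arguments riAut_dict k : clear implicits.

Definition extends (k : nat) (psi phi : pfun k) : Prop :=
  forall x y : word k, phi x = Some y -> psi x = Some y.

Definition is_max_ext (k : nat) (phi psi : pfun k) : Prop :=
  [/\ riAut k psi, extends psi phi
    & forall chi : pfun k, riAut k chi -> extends chi psi -> chi = psi].

(* Elements of [riAut k] have exactly one maximal extension; the default value
   of [xget] only matters for other partial functions. *)
Definition max_ext (k : nat) (phi : pfun k) : pfun k :=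
  xget phi [set psi | is_max_ext phi psi].

Definition G_k1 (k : nat) : set (pfun k) := @max_ext k @` riAut k.
Definition F_k1 (k : nat) : set (pfun k) := @max_ext k @` riAut_dict k.
Arguments G_k1 k : clear implicits.
Arguments F_k1 k : clear implicits.

Definition mulG (k : nat) (psi phi : pfun k) : pfun k :=
  max_ext (pcomp psi phi).

Definition oneG (k : nat) : pfun k := fun x => Some x.
Arguments oneG k : clear implicits.

(* Submonoids and suffix expansions are relative to a product and a unit on a
   type T in which the monoid lives as a subset. *)
Definition submonoid (T : Type) (mul : T -> T -> T) (one : T) : set (set T) :=
  [set H | H one /\ forall x y : T, H x -> H y -> H (mul x y)].

Definition generated (T : Type) (mul : T -> T -> T) (one : T) (X : set T) :
  set T := smallest (submonoid mul one) X.

(* (y, U) . (x, S) = (yx, Ux \cup S), where Ux = {ux : u \in U}. *)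
Definition mulL (T : Type) (mul : T -> T -> T) (p q : T * set T) : T * set T :=
  (mul p.1 q.1, [set mul u q.1 | u in p.2] `|` q.2).

(* The unit for [mulL] is (1, set0).  Pairs with infinite second component need
   not be excluded: those with a finite one form a submonoid containing the
   generators, hence all of the expansion. *)
Definition suffix_expansion (T : Type) (mul : T -> T -> T) (one : T)
    (Gamma : set T) : set (T * set T) :=
  generated (mulL mul) (one, set0)
    [set (gamma, [set gamma; one]) | gamma in Gamma].

Definition restrict (k : nat) (g : pfun k) (R : set (word k)) : pfun k :=
  fun x => if `[< R x >] then g x else None.

Definition rho (k : nat) (p : pfun k * set (pfun k)) : pfun k :=
  restrict p.1 (\bigcap_(h in p.2) Dom h).

Definition finite_to_one_map (X Y : Type) (A : set X) (B : set Y) (f : X -> Y) :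
  Prop :=
  set_fun A B f /\
  forall b : Y, B b -> finite_set (A `&` f @^-1` [set b]).

(* Main.v *)
Require Import Defs.
From mathcomp Require Import all_boot all_order.
From mathcomp Require Import boolp classical_sets functions cardinality.
From mathcomp Require Import finmap.

(** A finitely generated essential right ideal is a right ideal that contains
  every sufficiently long word, so the maximal extension of [phi] is the
  partial function [x |-> y] with [phi (x w) = y w] for all long [w]; it only
  depends on the values of [phi] on long words.

  Suppose [rho (g, S) = phi], and let [Dom phi] contain all words of length
  [n].  Then [g] is the maximal extension of [phi], and every [h] in [S] is
  defined on all words of length [n], hence determined by its values on them.
  Those values form a maximal prefix code with [k ^ n] elements.  Such a code
  has only words of length at most [k ^ n], because at each position of a
  longest word some other code word branches off.  So there are finitely many
  choices for [h], hence for [S]. *)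

Set Implicit Arguments.
Unset Strict Implicit.
Unset Printing Implicit Defensive.

Local Open Scope classical_set_scope.

(** * Finite sets and cancellation of suffixes *)

Lemma finite_set_subsets (T : choiceType) (A : set T) :
  finite_set A -> finite_set [set S | S `<=` A].
Proof.
move=> /finite_fsetP[X ->].
apply: (@sub_finite_set _ _ [set [set` Y] | Y in [set` fpowerset X]]); last first.
  exact/finite_image/finite_fset.
move=> S SX; have finS : finite_set S by exact: sub_finite_set SX (finite_fset X).
exists (fset_set S); last by rewrite fset_setK.
rewrite /= fpowersetE; apply/fsubsetP => x; rewrite in_fset_set // => /set_mem.
exact: SX.
Qed.

Lemma finite_set_inj (T U : Type) (f : T -> U) (A : set T) (B : set U) :
  {in A &, injective f} -> (forall x, A x -> B (f x)) -> finite_set B ->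
  finite_set A.
Proof.
move=> finj fAB finB; rewrite -(eq_finite_set (inj_card_eq finj)).
by apply: sub_finite_set finB => _ [x Ax <-]; exact: fAB.
Qed.

Lemma catr_inj (T : eqType) : left_injective (@cat T).
Proof.
move=> s1 s2 s3 e; have sz : size s2 = size s3.
  by apply/eqP; rewrite -(eqn_add2r (size s1)) -!size_cat e.
by move/eqP: e; rewrite eqseq_cat // => /andP[/eqP].
Qed.

(** * Finitely generated essential right ideals and long words *)

Section Words.
Variable k : nat.
Implicit Types (phi psi chi g h : pfun k) (x y w u v : word k).

Definition contains_long (R : set (word k)) (n : nat) : Prop :=
  forall x, (n <= size x)%N -> R x.

Lemma finite_set_short_words (n : nat) :
  finite_set [set x : word k | (size x <= n)%N].
Proof.
apply: (@sub_finite_set _ _ (range (fun s : n.-bseq 'I_k => val s))).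
  by move=> x /= xn; exists (Bseq xn).
exact/finite_image/finite_finset.
Qed.

Lemma fg_essential_riP (R : set (word k)) : (0 < k)%N ->
  fg_essential_ri R <-> right_ideal R /\ exists n, contains_long R n.
Proof.
move=> k0; split=> [[riR essR [C finC RE]]|[riR [n Rn]]].
  split=> //; have /finite_seqP[s sC] := finC.
  exists (\max_(c <- s) size c) => x xs.
  (* Essentiality is applied to the principal right ideal $xA^*$. As [x] is at least as long as
     every generator, a generator [c] below [z] is a prefix of [x]. *)
  have [z [Rz [w zw]]] : (R `&` [set z | exists w, z = x ++ w]) !=set0.
    apply: essR; last by exists x, [::]; rewrite cats0.
    by move=> z w [v ->]; exists (v ++ w); rewrite catA.
  move: (Rz); rewrite {1}RE => -[c [v [Cc zcv]]].
  have cx : (size c <= size x)%N.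
    apply: leq_trans xs; apply: (@leq_bigmax_seq _ s predT (fun c => size c)) => //.
    by move: Cc; rewrite sC.
  have xE : x = c ++ take (size x - size c) v.
    have := congr1 (take (size x)) (etrans (esym zw) zcv).
    by rewrite take_size_cat // take_cat ltnNge cx.
  by rewrite xE RE; exists c, (take (size x - size c) v).
split=> //.
  move=> R' riR' [x R'x]; exists (x ++ nseq n (Ordinal k0)); split; last exact: riR'.
  by apply: Rn; rewrite size_cat size_nseq leq_addl.
(* The words of [R] of length at most [n] generate it: a longer word is an extension of its prefix
   of length [n], which lies in [R]. *)
exists (R `&` [set x | (size x <= n)%N]).
  exact/finite_setIr/finite_set_short_words.
apply/seteqP; split=> [x Rx|_ [c [w [[Rc _] ->]]]]; last exact: riR.
exists (take n x), (drop n x); rewrite cat_take_drop; split=> //.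
have [xn|/ltnW nx] := leqP (size x) n.
  by rewrite take_oversize.
by split; [apply: Rn|]; rewrite /= size_takel.
Qed.

Definition equivariant phi : Prop :=
  forall x y w, phi x = Some y -> phi (x ++ w) = Some (y ++ w).

Definition pinj phi : Prop :=
  forall x x' y, phi x = Some y -> phi x' = Some y -> x = x'.

Lemma riAutP phi : (0 < k)%N ->
  riAut k phi <-> [/\ equivariant phi, pinj phi,
    exists n, contains_long (Dom phi) n & exists n, contains_long (Im phi) n].
Proof.
move=> k0; split=> [[] /(fg_essential_riP _ k0)[_ domn]|].
  by move=> /(fg_essential_riP _ k0)[_ imn] ? ?; split.
move=> [eqv inj domn imn]; split=> //; apply/fg_essential_riP => //; split=> //.
- by move=> x w [y xy]; exists (y ++ w); exact: eqv.
- by move=> y w [x xy]; exists (x ++ w); exact: eqv.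
Qed.

(** The prefix of [y] of length [n] has a preimage, possibly very short; the at least [m] remaining
    letters of [y] are appended to it. *)
Lemma im_of_long phi n m : equivariant phi -> contains_long (Im phi) n ->
  forall y, (n + m <= size y)%N -> exists2 x, (m <= size x)%N & phi x = Some y.
Proof.
move=> eqv imn y yn; have ny : (n <= size y)%N by exact: leq_trans (leq_addr _ _) yn.
have [x xE] := imn (take n y) (eq_leq (esym (size_takel ny))).
exists (x ++ drop n y); last by rewrite (eqv _ _ _ xE) cat_take_drop.
by rewrite size_cat size_drop; apply: leq_trans (leq_addl _ _); rewrite leq_subRL.
Qed.

(** * Maximal extensions as ultimate extensions *)

Definition ultimate phi x y : Prop :=
  exists n, forall w, (n <= size w)%N -> phi (x ++ w) = Some (y ++ w).

(** There is at most one such [y] by [ultimate_fun]; the default [None] marks the words outside the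
    domain. *)
Definition ultimate_ext phi : pfun k :=
  fun x => xget None [set o | exists2 y, o = Some y & ultimate phi x y].

Hypothesis k_gt0 : (0 < k)%N.

Lemma ultimate_fun phi x y y' : ultimate phi x y -> ultimate phi x y' -> y = y'.
Proof.
move=> [n yn] [m ym]; pose w := nseq (maxn n m) (Ordinal k_gt0).
have := yn w; have := ym w; rewrite size_nseq leq_maxl leq_maxr.
by move=> -> // /(_ isT)[/catr_inj].
Qed.

Lemma ultimate_extP phi x y : ultimate_ext phi x = Some y <-> ultimate phi x y.
Proof.
rewrite /ultimate_ext; split=> [|phixy].
  by case: xgetP => [o -> [z -> ?] [<-]|].
apply: xget_unique; first by exists y.
by move=> _ [z -> ?]; congr Some; apply: ultimate_fun phixy.
Qed.

Lemma ultimate_ext_extends phi : equivariant phi -> extends (ultimate_ext phi) phi.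
Proof. by move=> eqv x y xy; apply/ultimate_extP; exists 0 => w _; exact: eqv. Qed.

Lemma ultimate_ext_eqv phi : equivariant (ultimate_ext phi).
Proof.
move=> x y w /ultimate_extP[n xyn]; apply/ultimate_extP; exists n => v nv.
by rewrite -!catA xyn // size_cat (leq_trans nv) // leq_addl.
Qed.

Lemma ultimate_ext_inj phi : pinj phi -> pinj (ultimate_ext phi).
Proof.
move=> inj x x' y /ultimate_extP[n yn] /ultimate_extP[m ym].
pose w := nseq (maxn n m) (Ordinal k_gt0).
have := yn w; have := ym w; rewrite size_nseq leq_maxl leq_maxr.
by move=> /(_ isT) xw /(_ isT) x'w; apply: (@catr_inj _ w); exact: inj x'w xw.
Qed.

Lemma ultimate_ext_riAut phi : riAut k phi -> riAut k (ultimate_ext phi).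
Proof.
move=> /(riAutP _ k_gt0)[eqv inj [n domn] [m imm]]; apply/riAutP => //.
have ext := ultimate_ext_extends eqv.
split; [exact: ultimate_ext_eqv|exact: ultimate_ext_inj|exists n|exists m].
  by move=> x /domn[y xy]; exists y; exact: ext.
by move=> y /imm[x xy]; exists x; exact: ext.
Qed.

Lemma long_cat (n : nat) x w : (n <= size w)%N -> (n <= size (x ++ w))%N.
Proof. by rewrite size_cat => /leq_trans; apply; exact: leq_addl. Qed.

Lemma ultimate_ext_agree phi psi n :
  (forall x, (n <= size x)%N -> phi x = psi x) ->
  ultimate_ext phi = ultimate_ext psi.
Proof.
have sub f f' x y : (forall x, (n <= size x)%N -> f x = f' x) ->
    ultimate f x y -> ultimate f' x y.
  move=> ff' [m fm]; exists (maxn n m) => w; rewrite geq_max => /andP[nw mw].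
  by rewrite -ff' ?fm //; exact: long_cat.
move=> agree; apply/funext => x.
case E : (ultimate_ext phi x) => [y|]; case E' : (ultimate_ext psi x) => [y'|] //.
- move/ultimate_extP: E => /(sub _ _ _ _ agree) /ultimate_extP E.
  by rewrite -E' E.
- move/ultimate_extP: E => /(sub _ _ _ _ agree) /ultimate_extP E.
  by rewrite -E' E.
move/ultimate_extP: E' => /(sub psi phi) E'; rewrite -E; apply/ultimate_extP.
by apply: E' => z nz; rewrite agree.
Qed.

(** Once [x ++ w] is long enough to lie in [Dom phi], [phi] and [chi] agree there, and equivariance
    of [chi] gives the value. *)
Lemma extends_sub_ultimate_ext phi chi : riAut k phi -> riAut k chi ->
  extends chi phi -> extends (ultimate_ext phi) chi.
Proof.
move=> /(riAutP _ k_gt0)[_ _ [n domn] _] /(riAutP _ k_gt0)[eqv _ _ _] ext x y xy.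
apply/ultimate_extP; exists n => w nw.
have [z xwz] := domn _ (long_cat x nw).
by rewrite xwz -(ext _ _ xwz) (eqv _ _ _ xy).
Qed.

Lemma extends_trans phi psi chi : extends chi psi -> extends psi phi -> extends chi phi.
Proof. by move=> e e' x y /e'/e. Qed.

Lemma extends_anti phi psi : extends phi psi -> extends psi phi -> phi = psi.
Proof.
move=> e e'; apply/funext => x; case E : (phi x) => [y|]; first by rewrite (e' _ _ E).
by case E' : (psi x) => [y|] //; rewrite (e _ _ E') in E.
Qed.

(** Among the extensions of [phi] in [riAut k], the ultimate one is the greatest, hence the only
    maximal one. *)
Lemma max_extE phi : riAut k phi -> max_ext phi = ultimate_ext phi.
Proof.
move=> aphi; have [eqv _ _ _] := (riAutP _ k_gt0).1 aphi.
have ext := ultimate_ext_extends eqv; have aut := ultimate_ext_riAut aphi.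
apply: xget_unique => [|psi [apsi epsi maxpsi]].
  split=> // chi achi echi; apply: extends_anti => //.
  apply: extends_sub_ultimate_ext => //; exact: extends_trans echi ext.
by rewrite [RHS](maxpsi _ aut) //; exact: extends_sub_ultimate_ext.
Qed.

Lemma G_k1_riAut g : G_k1 k g -> riAut k g.
Proof. by move=> [phi aphi <-]; rewrite max_extE //; exact: ultimate_ext_riAut. Qed.

(** Taking ultimate extensions is idempotent, since [phi] and [ultimate_ext phi] agree on long
    words. Thus [g] is recovered from its values on long words. *)
Lemma G_k1_ultimate_ext g : G_k1 k g -> ultimate_ext g = g.
Proof.
move=> [phi aphi <-]; rewrite max_extE //; have [eqv _ [n domn] _] := (riAutP _ k_gt0).1 aphi.
apply: (@ultimate_ext_agree _ _ n) => x /domn[y xy].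
by rewrite xy (ultimate_ext_extends eqv xy).
Qed.

Lemma F_k1_sub_G_k1 : F_k1 k `<=` G_k1 k.
Proof. by move=> g [phi [aphi _] <-]; exists phi. Qed.

(** * The dictionary order *)

Lemma dict_le_prefix x w : dict_le x (x ++ w).
Proof.
rewrite /dict_le; elim: x => [|a x IH] //=.
by rewrite lexi_cons Order.POrderTheory.lexx.
Qed.

Lemma dict_le_cat x x' w w' : ~~ prefix x x' -> ~~ prefix x' x ->
  dict_le (x ++ w) (x' ++ w') <-> dict_le x x'.
Proof.
rewrite /dict_le; elim: x x' => [|a x IH] [|b x'] //=.
rewrite [b == a]eq_sym !lexi_cons => nab nba.
case: (Order.TotalTheory.ltgtP a b) nab nba => //= ab; exact: IH.
Qed.

Lemma F_k1_dict_preserving g : F_k1 k g -> dict_preserving g.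
Proof.
move=> [phi [aphi dphi] <-]; rewrite max_extE // => x x' y y' xy xy'.
have [eqv inj _ _] := (riAutP _ k_gt0).1 (ultimate_ext_riAut aphi).
have prefE u u' v v' : ultimate_ext phi u = Some v -> ultimate_ext phi u' = Some v' ->
    prefix v v' -> prefix u u'.
  move=> uv uv' /prefixP[w vE]; rewrite vE in uv'.
  by apply/prefixP; exists w; exact: inj uv' (eqv _ _ _ uv).
have [/prefixP[w x'E] _|nxx'] := boolP (prefix x x').
  suff -> : y' = y ++ w by exact: dict_le_prefix.
  by apply: Some_inj; rewrite -xy' x'E; exact: eqv.
have [/prefixP[w xE]|nx'x] := boolP (prefix x' x).
  (* A prefix comes first, so here [x'] is below [x] as well and the two words coincide. *)
  move=> le; suff -> : y = y' by have := dict_le_prefix y' [::]; rewrite cats0.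
  apply: Some_inj; rewrite -xy -xy'; congr ultimate_ext.
  apply: (@Order.POrderTheory.le_anti _ (seqlexi 'I_k)); rewrite le /=.
  by rewrite xE; exact: dict_le_prefix.
(* For incomparable words, suffixes lead into [Dom phi], where the order is preserved. By [prefE]
   the images are incomparable too, so suffixes affect neither comparison. *)
have /ultimate_extP[n phix] := xy; have /ultimate_extP[n' phix'] := xy'.
have sz m : (m <= size (nseq m (Ordinal k_gt0)))%N by rewrite size_nseq.
move=> /(dict_le_cat (nseq n (Ordinal k_gt0)) (nseq n' (Ordinal k_gt0)) nxx' nx'x).
move=> /(dphi _ _ _ _ (phix _ (sz n)) (phix' _ (sz n'))) /dict_le_cat; apply.
  by apply: contra nxx'; exact: prefE.
by apply: contra nx'x; exact: prefE.
Qed.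

(** * Finiteness of the set of maps defined on all words of length n *)

Lemma size_image_le h n x y : (1 < k)%N -> riAut k h ->
  contains_long (Dom h) n -> size x = n -> h x = Some y -> (size y <= k ^ n)%N.
Proof.
move=> k_gt1 /(riAutP _ k_gt0)[eqv inj _ [m imm]] domn xn xy.
pose d := Ordinal k_gt0.
(* The image [v] of [u] leaves [y] exactly at position [i]. Choosing such a [u] for each position
   injects the positions of [y] into the $k^n$ words of length [n]. *)
pose branch (i : 'I_(size y)) (u : n.-tuple 'I_k) := exists v,
  [/\ h u = Some v, take i v = take i y & nth d v i != nth d y i].
have [f fP] : {f & forall i, branch i (f i)}.
  apply: choice => i.
  have [a ay] : exists a, a != nth d y i.
    have [->|] := eqVneq (nth d y i) d; first by exists (Ordinal k_gt1).
    by exists d; rewrite eq_sym.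
  have iy : size (take i y) = i by rewrite size_takel // ltnW.
  (* The padding by [m + n] letters puts the word in the image, with a preimage of length at least
     [n] that can be cut to its first [n] letters. *)
  have [|x0 nx0 hx0] := im_of_long (m := n) eqv imm (y := take i y ++ a :: nseq (m + n) d).
    by apply: long_cat; rewrite /= size_nseq.
  have [v uv] := domn (take n x0) (eq_leq (esym (size_takel nx0))).
  have vE : v ++ drop n x0 = take i y ++ a :: nseq (m + n) d.
    by apply: Some_inj; rewrite -hx0 -(eqv _ _ _ uv) cat_take_drop.
  have tz : size (take n x0) == n by rewrite size_takel.
  exists (Tuple tz), v; rewrite /=.
  (* If [v] ended by position [i], it would be a proper prefix of [y]; by injectivity [x] would
     properly extend a word of its own length [n]. *)
  have [vi|iv] := leqP (size v) i.
    have yE : y = v ++ drop (size v) y.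
      rewrite -{1}[y](cat_take_drop (size v)); congr cat.
      have := congr1 (take (size v)) vE.
      by rewrite take_size_cat // takel_cat ?iy // take_takel.
    have := inj _ _ _ xy (etrans (eqv _ _ (drop (size v) y) uv) (congr1 Some (esym yE))).
    move=> /(congr1 size)/eqP; rewrite size_cat size_takel // xn -{1}[n]addn0 eqn_add2l.
    by rewrite size_drop eq_sym subn_eq0 leqNgt (leq_ltn_trans vi).
  split=> //.
    by have := congr1 (take i) vE; rewrite takel_cat 1?ltnW // take_size_cat.
  have := congr1 (fun s => nth d s i) vE.
  by rewrite nth_cat iv nth_cat iy ltnn subnn /= => ->.
rewrite -[size y]card_ord -[k in leqRHS]card_ord -card_tuple.
apply: (@leq_card _ _ f) => i j.
wlog ij : i j / (i <= j)%N.
  by move=> wl; have [/wl|/ltnW/wl w /esym/w] := leqP i j.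
move: ij; rewrite leq_eqVlt => /orP[/eqP/val_inj //|ij] fij.
(* If [i < j] shared the same word, its image would agree with [y] before [j] and yet differ from it
   at [i]. *)
have [v [uv _ nv]] := fP i; have [v' [uv' tv' _]] := fP j.
have vv' : v = v' by apply: Some_inj; rewrite -uv -uv' fij.
by rewrite -(nth_take d ij y) -tv' nth_take // vv' eqxx in nv.
Qed.

Lemma finite_G_k1_Dom_sup n : (1 < k)%N ->
  finite_set [set h | G_k1 k h /\ contains_long (Dom h) n].
Proof.
move=> k_gt1; pose N := (k ^ n)%N.
(* A finite table of the values on words of length [n]. Neither default value occurs for the maps
   considered: they are defined there, and [size_image_le] bounds their values by [N]. *)
pose code h := [ffun u : n.-tuple 'I_k => insub_bseq N (odflt [::] (h u))].
apply: (@finite_set_inj _ _ code _ setT) => //.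
move=> g h /set_mem[Gg domg] /set_mem[Gh domh] gh.
have ag := G_k1_riAut Gg; have ah := G_k1_riAut Gh.
rewrite -(G_k1_ultimate_ext Gg) -(G_k1_ultimate_ext Gh).
apply: (@ultimate_ext_agree _ _ n) => x nx.
have tn : size (take n x) = n by rewrite size_takel.
have [y xy] := domg (take n x) (eq_leq (esym tn)).
have [z xz] := domh (take n x) (eq_leq (esym tn)).
have [eqvg _ _ _] := (riAutP _ k_gt0).1 ag.
have [eqvh _ _ _] := (riAutP _ k_gt0).1 ah.
rewrite -(cat_take_drop n x) (eqvg _ _ _ xy) (eqvh _ _ _ xz); congr (Some (_ ++ _)).
have /ffunP/(_ (tcast tn (in_tuple (take n x)))) := gh.
rewrite /code !ffunE val_tcast xy xz /= => /(congr1 val).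
rewrite /insub_bseq /= !insubdK //.
- exact: size_image_le k_gt1 ah domh tn xz.
- exact: size_image_le k_gt1 ag domg tn xy.
Qed.

(** * The map rho and its fibres *)

Lemma restrictP g (R : set (word k)) x y :
  Defs.restrict g R x = Some y <-> R x /\ g x = Some y.
Proof. by rewrite /Defs.restrict; case: asboolP => Rx; split=> // -[]. Qed.

Lemma contains_long_bigcap (S : set (pfun k)) : finite_set S -> S `<=` riAut k ->
  exists n, contains_long (\bigcap_(h in S) Dom h) n.
Proof.
move=> /finite_seqP[s ->] Saut.
have [N NP] : {N : pfun k -> nat & forall h, h \in s -> contains_long (Dom h) (N h)}.
  apply: (@choice _ _ (fun h n => h \in s -> contains_long (Dom h) n)) => h.
  have [hs|] := boolP (h \in s); last by exists 0.
  by have [_ _ [n hn] _] := (riAutP _ k_gt0).1 (Saut _ hs); exists n.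
exists (\max_(h <- s) N h) => x xN h /= hs; apply: NP => //.
by apply: leq_trans xN; apply: (@leq_bigmax_seq _ s predT N).
Qed.

Lemma rho_riAut (p : pfun k * set (pfun k)) : riAut k p.1 -> p.2 `<=` riAut k ->
  finite_set p.2 -> riAut k (rho p).
Proof.
case: p => g S /= ag aS finS; have [n Rn] := contains_long_bigcap finS aS.
have [eqv inj [m domm] [l iml]] := (riAutP _ k_gt0).1 ag.
apply/riAutP => //; rewrite /rho /=; split.
- move=> x y w /restrictP[Rx xy]; apply/restrictP; split; last exact: eqv.
  move=> h Sh; have [z hz] := Rx h Sh; have [eqvh _ _ _] := (riAutP _ k_gt0).1 (aS _ Sh).
  by exists (z ++ w); exact: eqvh.
- by move=> x x' y /restrictP[_ xy] /restrictP[_]; exact: inj.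
- exists (maxn m n) => x; rewrite geq_max => /andP[/domm[y xy] /Rn Rx].
  by exists y; apply/restrictP.
(* Images this long have preimages of length at least [n], which survive the restriction. *)
- exists (l + n)%N => y /(im_of_long eqv iml)[x /Rn Rx xy].
  by exists x; apply/restrictP.
Qed.

Lemma finite_rho_fiber phi : (1 < k)%N -> riAut k phi ->
  finite_set [set p : pfun k * set (pfun k) |
    [/\ G_k1 k p.1, p.2 `<=` G_k1 k & rho p = phi]].
Proof.
move=> k_gt1 /(riAutP _ k_gt0)[_ _ [n domn] _].
pose H := [set h | G_k1 k h /\ contains_long (Dom h) n].
(* The first component is forced because [phi] agrees with it on long words; the second is a subset
   of the finite set [H], as [Dom phi] lies in each [Dom h]. *)
apply: (@sub_finite_set _ _ ([set ultimate_ext phi] `*` [set S | S `<=` H])).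
  move=> [g S] /= [Gg GS phiE]; split=> /=.
    rewrite -(G_k1_ultimate_ext Gg); apply: (@ultimate_ext_agree _ _ n) => x /domn[y xy].
    by rewrite xy; move: xy; rewrite -phiE => /restrictP[].
  move=> h Sh; split; first exact: GS.
  by move=> x /domn[y]; rewrite -phiE => /restrictP[+ _]; exact.
apply: finite_setX; first exact: finite_set1.
exact/finite_set_subsets/finite_G_k1_Dom_sup.
Qed.

End Words.

(** * Suffix expansions and the conclusion *)

Lemma generated_submonoid (T : Type) (mul : T -> T -> T) (one : T) (X : set T) :
  submonoid mul one (generated mul one X).
Proof.
split=> [H [[H1 _] _] //|x y Xx Xy H HX].
by apply: HX.1.2; [exact: Xx|exact: Xy].
Qed.

(** The pairs on the right form a submonoid containing the generators; this is all that the fibre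
    argument needs to know about the expansion. *)
Lemma suffix_expansion_sub (T : Type) (mul : T -> T -> T) (one : T) (X : set T) :
  suffix_expansion mul one X `<=`
    [set p | [/\ generated mul one X p.1, p.2 `<=` generated mul one X
               & finite_set p.2]].
Proof.
have [M1 MM] := generated_submonoid mul one X.
apply: smallest_sub; first split.
- by split.
- move=> [y U] [x S] /= [My MU finU] [Mx MS finS]; split=> /=.
  + exact: MM.
  + by move=> _ [[u Uu <-]|/MS //]; apply: MM => //; exact: MU.
  + by rewrite finite_setU; split=> //; exact: finite_image.
- move=> _ [g Xg <-] /=; have Mg : generated mul one X g by exact: sub_gen_smallest.
  by split=> // _ [->|->].
Qed.

Theorem proposition5p1 (k : nat) (hk : (2 <= k)%N) :
  (forall Gamma : set (pfun k),
     generated (@mulG k) (oneG k) Gamma = G_k1 k ->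
     finite_to_one_map (suffix_expansion (@mulG k) (oneG k) Gamma)
       (riAut k) (@rho k))
  /\
  (forall Gamma : set (pfun k),
     generated (@mulG k) (oneG k) Gamma = F_k1 k ->
     finite_to_one_map (suffix_expansion (@mulG k) (oneG k) Gamma)
       (riAut_dict k) (@rho k)).
Proof.
have k_gt0 : (0 < k)%N by exact: ltnW.
have G_rho p : G_k1 k p.1 -> p.2 `<=` G_k1 k -> finite_set p.2 -> riAut k (rho p).
  move=> /(G_k1_riAut k_gt0) ag GS; apply: rho_riAut => // h /GS.
  exact: G_k1_riAut.
split=> Gamma gen; have := @suffix_expansion_sub _ (@mulG k) (oneG k) Gamma.
  rewrite gen => sub; split=> [p /sub[]|phi aphi]; first exact: G_rho.
  apply: sub_finite_set (finite_rho_fiber k_gt0 hk aphi).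
  by move=> p [/sub[Gp GS _] pE].
rewrite gen => sub; have FG := @F_k1_sub_G_k1 k.
split=> [p /sub[Fp FS finS]|phi [aphi _]].
  split; first by apply: G_rho => //; [exact: FG|exact: subset_trans FG].
  move=> x x' y y' /restrictP[_ xy] /restrictP[_ xy'].
  exact: (F_k1_dict_preserving k_gt0 Fp) xy xy'.
(* The fibre over pairs from $G_{k,1}$ is finite independently of [Gamma], so it also bounds the
   fibre for $F_{k,1}$. *)
apply: sub_finite_set (finite_rho_fiber k_gt0 hk aphi).
by move=> p [/sub[Fp FS _] pE]; split=> //; [exact: FG|exact: subset_trans FG].
Qed.
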